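(* Let $A=[a_{rs}]$ be a strictly upper triangular binary $n\times n$ matrix with exactly two non-zero rows, those with indices $i<j$, such that the real Bott manifold $M(A)$ is orientable. Let $k,l,m\ge 0$ and $i_1\ge 0$ be integers with $i_1+2k+2l+2m+3\le n$. 1. Suppose that $a_{i,r}=1$ exactly for $r\in\{i_1+1,\dots,i_1+2k+2l+2\}$ and $a_{j,s}=1$ exactly for $s\in\{i_1+2k+2,\dots,i_1+2k+2l+2m+3\}$. Then $M(A)$ admits a Spin-structure if and only if $l$ and $m$ have the same parity and $j\in\{i_1+1,\dots,i_1+2k+2\}$. 2. Suppose that $a_{j,r}=1$ exactly for $r\in\{i_1+1,\dots,i_1+2k+2l+2\}$ and $a_{i,s}=1$ exactly for $s\in\{i_1+2k+2,\dots,i_1+2k+2l+2m+3\}$. Then $M(A)$ has no Spin-structure.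
   Context: For a strictly upper triangular $n\times n$ matrix $A=[a_{ij}]$ with entries in $\{0,1\}$, the real Bott manifold $M(A)$ is the flat manifold $\mathbb{R}^n/\Gamma(A)$, where $\Gamma(A)\subset \operatorname{Isom}(\mathbb{R}^n)=O(n)\ltimes\mathbb{R}^n$ is the group generated by $s_1,\dots,s_n$, with $s_i=(\operatorname{diag}((-1)^{a_{i1}},\dots,(-1)^{a_{in}}),\ \tfrac12 e_i)$ and $e_i$ the $i$-th standard basis vector. $M(A)$ is orientable if and only if the sum of the entries in each row of $A$ is even. An oriented flat manifold $\mathbb{R}^n/\Gamma$, with $\Gamma\subset SO(n)\ltimes\mathbb{R}^n$ its fundamental group and $p$ the projection to $SO(n)$, has a Spin-structure if and only if there is a homomorphism $\epsilon:\Gamma\to\operatorname{Spin}(n)$ with $\lambda_n\epsilon=p$, where $\lambda_n:\operatorname{Spin}(n)\to SO(n)$ is the covering map; equivalently, its second Stiefel–Whitney class $w_2$ vanishes. *)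

(* Defs.v *)
From HB Require Import structures.
From mathcomp Require Import all_boot all_order all_algebra.
From mathcomp Require Import ring reals.

Set Implicit Arguments.
Unset Strict Implicit.
Unset Printing Implicit Defensive.

Import Order.TTheory GRing.Theory Num.Theory.
Local Open Scope ring_scope.

(******************************************************************************)
(* The Clifford algebra C_n with generators e_0, ..., e_(n-1) and relations   *)
(* e_i ^+ 2 = -1, e_i * e_j = - e_j * e_i for i != j.                         *)
(* An element is its family of coordinates in the basis (e_S), where for      *)
(* S = {s_1 < ... < s_k} we put e_S = e_(s_1) * ... * e_(s_k).                *)
(******************************************************************************)

Section SymDiff.
Variable T : finType.
Implicit Types A B C : {set T}.

Definition setSD A B : {set T} := (A :\: B) :|: (B :\: A).

Lemma in_setSD A B x : (x \in setSD A B) = (x \in A) (+) (x \in B).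
Proof. by rewrite !inE; case: (x \in A); case: (x \in B). Qed.

Lemma setSDC : commutative setSD.
Proof. by move=> A B; apply/setP=> x; rewrite !in_setSD addbC. Qed.

Lemma setSDA : associative setSD.
Proof. by move=> A B C; apply/setP=> x; rewrite !in_setSD addbA. Qed.

Lemma set0SD : left_id set0 setSD.
Proof. by move=> A; apply/setP=> x; rewrite in_setSD inE. Qed.

Lemma setSD0 : right_id set0 setSD.
Proof. by move=> A; rewrite setSDC set0SD. Qed.

Lemma setSDv A : setSD A A = set0.
Proof. by apply/setP=> x; rewrite in_setSD addbb inE. Qed.

Lemma setSDK A B : setSD A (setSD A B) = B.
Proof. by rewrite setSDA setSDv set0SD. Qed.

Lemma setSD_eq A B C : (setSD A B == C) = (B == setSD A C).
Proof.
by apply/eqP/eqP => [<-|->]; rewrite setSDK.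
Qed.
End SymDiff.

Definition clifford (R : Type) (n : nat) := {ffun {set 'I_n} -> R}.

HB.instance Definition _ (R : comNzRingType) n :=
  GRing.Lmodule.copy (clifford R n) {ffun {set 'I_n} -> R^o}.

Section Clifford.
Variables (R : comNzRingType) (n : nat).
Implicit Types (S T U : {set 'I_n}) (x y z : clifford R n) (u v : 'cV[R]_n).

(* e_S * e_T = cl_sign S T *: e_(setSD S T): in reordering the concatenation, *)
(* each pair t < s is one transposition, and each t = s is one e_t ^+ 2 = -1. *)
Definition cl_sign S T : R := \prod_(s in S) \prod_(t in T | (t <= s)%N) -1.

Definition cl_basis S : clifford R n := [ffun T => (T == S)%:R].

Definition cl_mul x y : clifford R n :=
  [ffun U => \sum_S \sum_(T | setSD S T == U) cl_sign S T * x S * y T].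

Definition cl_one : clifford R n := cl_basis set0.

Lemma cl_signE S T :
  cl_sign S T =
  \prod_s \prod_t (-1) ^+ [&& s \in S, t \in T & (t <= s)%N].
Proof.
rewrite /cl_sign [LHS]big_mkcond; apply: eq_bigr => s _.
case: (s \in S) => /=; last by rewrite big1 // => t _; rewrite expr0.
rewrite big_mkcond; apply: eq_bigr => t _.
by case: (_ && _); rewrite ?expr1 ?expr0.
Qed.

Lemma cl_signDl S T U : cl_sign (setSD S T) U = cl_sign S U * cl_sign T U.
Proof.
rewrite !cl_signE -big_split; apply: eq_bigr => s _.
rewrite -big_split; apply: eq_bigr => t _; rewrite in_setSD /=.
case: (s \in S); case: (s \in T); case: (t \in U); case: (_ <= _)%N;
  by rewrite /= ?expr0 ?expr1 ?mulr1 ?mul1r ?mulrNN ?mulr1.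
Qed.

Lemma cl_signDr S T U : cl_sign S (setSD T U) = cl_sign S T * cl_sign S U.
Proof.
rewrite !cl_signE -big_split; apply: eq_bigr => s _.
rewrite -big_split; apply: eq_bigr => t _; rewrite in_setSD /=.
case: (s \in S); case: (t \in T); case: (t \in U); case: (_ <= _)%N;
  by rewrite /= ?expr0 ?expr1 ?mulr1 ?mul1r ?mulrNN ?mulr1.
Qed.

Lemma cl_sign0l S : cl_sign set0 S = 1.
Proof. by rewrite /cl_sign big_set0. Qed.

Lemma cl_sign0r S : cl_sign S set0 = 1.
Proof.
by rewrite /cl_sign big1 // => s _; rewrite big_pred0 // => t; rewrite inE.
Qed.

Lemma cl_sign_sqr S T : cl_sign S T * cl_sign S T = 1.
Proof. by rewrite -cl_signDr setSDv cl_sign0r. Qed.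

Lemma cl_sign1 (i j : 'I_n) :
  cl_sign [set i] [set j] = (-1) ^+ (j <= i)%N.
Proof.
rewrite /cl_sign big_set1 big_mkcondr big_set1.
by case: (_ <= _)%N; rewrite ?expr1 ?expr0.
Qed.

Lemma cl_mulE x y U :
  cl_mul x y U =
  \sum_S cl_sign S (setSD S U) * x S * y (setSD S U).
Proof.
rewrite ffunE; apply: eq_bigr => S _.
by rewrite (eq_bigl (pred1 (setSD S U))) ?big_pred1_eq // => T; exact: setSD_eq.
Qed.

Lemma cl_mulA : associative cl_mul.
Proof.
move=> x y z; apply/ffunP => U; rewrite !cl_mulE.
under eq_bigr do rewrite cl_mulE mulr_sumr.
under [RHS]eq_bigr do rewrite cl_mulE mulr_sumr mulr_suml.
rewrite [RHS]exchange_big; apply: eq_bigr => S _ /=.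
rewrite [RHS](reindex_inj (can_inj (setSDK S))) /=; apply: eq_bigr => T _.
rewrite setSDK -!setSDA [setSD T (setSD S U)]setSDA [setSD T S]setSDC.
rewrite -[setSD (setSD S T) U]setSDA; set V := setSD S (setSD T U).
have E : setSD T V = setSD S U.
  by rewrite /V setSDA [setSD T S]setSDC -setSDA setSDK.
rewrite cl_signDl -E cl_signDr; ring.
Qed.

Lemma cl_mul1l : left_id (cl_one) cl_mul.
Proof.
move=> x; apply/ffunP => U; rewrite cl_mulE (bigD1 set0) //= big1 => [|S /negPf nS].
  by rewrite ffunE eqxx set0SD cl_sign0l !mul1r addr0.
by rewrite ffunE nS mulr0 mul0r.
Qed.

Lemma cl_mul1r : right_id (cl_one) cl_mul.
Proof.
move=> x; apply/ffunP => U; rewrite cl_mulE (bigD1 U) //= big1 => [|S nS].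
  by rewrite ffunE setSDv eqxx cl_sign0r mul1r mulr1 addr0.
rewrite ffunE setSD_eq setSD0 eq_sym (negPf nS) mulr0 //.
Qed.

Lemma cl_mulDl : left_distributive cl_mul +%R.
Proof.
move=> x y z; apply/ffunP => U; rewrite [RHS]ffunE !cl_mulE -big_split.
by apply: eq_bigr => S _; rewrite !ffunE mulrDr mulrDl.
Qed.

Lemma cl_mulDr : right_distributive cl_mul +%R.
Proof.
move=> x y z; apply/ffunP => U; rewrite [RHS]ffunE !cl_mulE -big_split.
by apply: eq_bigr => S _; rewrite !ffunE mulrDr.
Qed.

Lemma cl_one_neq0 : cl_one != 0.
Proof.
apply/eqP => /ffunP /(_ set0); rewrite !ffunE eqxx => /eqP.
by rewrite oner_eq0.
Qed.

HB.instance Definition _ := GRing.Zmodule_isNzRing.Build (clifford R n)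
  cl_mulA cl_mul1l cl_mul1r cl_mulDl cl_mulDr cl_one_neq0.

Lemma cl_mulrE x y U :
  (x * y) U = \sum_S cl_sign S (setSD S U) * x S * y (setSD S U).
Proof. exact: cl_mulE. Qed.

Lemma cl_scalerAl (a : R) x y : a *: (x * y) = (a *: x) * y.
Proof.
apply/ffunP => U; rewrite [LHS]ffunE !cl_mulrE.
rewrite scaler_sumr; apply: eq_bigr => S _.
by rewrite ffunE /GRing.scale /=; ring.
Qed.

HB.instance Definition _ :=
  GRing.Lmodule_isLalgebra.Build R (clifford R n) cl_scalerAl.

Lemma cl_scalerAr (a : R) x y : a *: (x * y) = x * (a *: y).
Proof.
apply/ffunP => U; rewrite [LHS]ffunE !cl_mulrE.
rewrite scaler_sumr; apply: eq_bigr => S _.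
by rewrite ffunE /GRing.scale /=; ring.
Qed.

HB.instance Definition _ :=
  GRing.Lalgebra_isAlgebra.Build R (clifford R n) cl_scalerAr.

Lemma cl_basisM S T :
  cl_basis S * cl_basis T = cl_sign S T *: cl_basis (setSD S T).
Proof.
apply/ffunP => U; rewrite cl_mulrE (bigD1 S) //= big1 => [|S' nS'].
  rewrite !ffunE eqxx addr0 mulr1 setSD_eq /GRing.scale /=.
  by case: eqP => [->|_]; rewrite ?mulr0 // setSDK.
by rewrite ffunE (negPf nS') mulr0 mul0r.
Qed.

Lemma cl_sum_basis x : x = \sum_S x S *: cl_basis S.
Proof.
apply/ffunP => U; rewrite sum_ffunE (bigD1 U) //= big1 => [|S nS].
  by rewrite !ffunE eqxx /GRing.scale /= mulr1 addr0.
by rewrite !ffunE eq_sym (negPf nS) scaler0.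
Qed.

Definition cl_gen (i : 'I_n) : clifford R n := cl_basis [set i].

Lemma cl_gen_sqr i : cl_gen i * cl_gen i = -1.
Proof. by rewrite cl_basisM setSDv cl_sign1 leqnn expr1 scaleN1r. Qed.

Lemma cl_gen_anticomm i j : i != j ->
  cl_gen i * cl_gen j = - (cl_gen j * cl_gen i).
Proof.
move=> nij; rewrite !cl_basisM setSDC -scaleNr !cl_sign1.
congr (_ *: _).
have [lt_ij|lt_ji|/val_inj eq_ij] := ltngtP i j.
- by rewrite expr0 expr1 opprK.
- by rewrite expr0 expr1.
- by rewrite eq_ij eqxx in nij.
Qed.

Definition cl_vec v : clifford R n := \sum_i v i 0 *: cl_gen i.

(* The anti-automorphism of C_n with v |-> - v on R^n, that is, the reversal *)
(* composed with the parity automorphism. As (e_i)^-1 = - e_i, it maps e_S   *)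
(* to (e_S)^-1 = cl_sign S S *: e_S.                                         *)
Definition cl_conj x : clifford R n := [ffun S => cl_sign S S * x S].

Lemma cl_conjM x y : cl_conj (x * y) = cl_conj y * cl_conj x.
Proof.
apply/ffunP => U; rewrite [LHS]ffunE !cl_mulrE mulr_sumr.
rewrite [RHS](reindex_inj (can_inj (fun S => setSDK U S))) /=.
apply: eq_bigr => S _; rewrite !ffunE.
rewrite [setSD U S]setSDC.
have -> : setSD (setSD S U) U = S by rewrite setSDC [setSD S U]setSDC setSDK.
move: (setSD S U) (esym (setSDK S U)) => T ->.
rewrite !cl_signDl !cl_signDr.
have := cl_sign_sqr S T; set a := cl_sign S T => aa.
ring: aa.
Qed.

Lemma cl_conjD x y : cl_conj (x + y) = cl_conj x + cl_conj y.
Proof. by apply/ffunP => U; rewrite !ffunE mulrDr. Qed.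

Lemma cl_conjZ a x : cl_conj (a *: x) = a *: cl_conj x.
Proof. by apply/ffunP => U; rewrite !ffunE /GRing.scale /=; ring. Qed.

Lemma cl_conj_basis S : cl_conj (cl_basis S) = cl_sign S S *: cl_basis S.
Proof.
apply/ffunP => U; rewrite !ffunE /GRing.scale /=.
by case: eqP => [->|]; rewrite ?mulr0.
Qed.

Lemma cl_conj1 : cl_conj 1 = 1.
Proof. by rewrite cl_conj_basis cl_sign0l scale1r. Qed.

Lemma cl_conj_sum I (r : seq I) P (F : I -> clifford R n) :
  cl_conj (\sum_(i <- r | P i) F i) = \sum_(i <- r | P i) cl_conj (F i).
Proof.
elim/big_rec2: _ => [|i y1 y2 _ <-]; last by rewrite cl_conjD.
by apply/ffunP => U; rewrite !ffunE mulr0.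
Qed.

Lemma cl_conj_vec v : cl_conj (cl_vec v) = - cl_vec v.
Proof.
rewrite cl_conj_sum -sumrN; apply: eq_bigr => i _.
by rewrite cl_conjZ cl_conj_basis cl_sign1 leqnn expr1 scaleN1r scalerN.
Qed.

Lemma cl_vecE v S : cl_vec v S = \sum_i v i 0 * (S == [set i])%:R.
Proof. by rewrite sum_ffunE; apply: eq_bigr => i _; rewrite !ffunE. Qed.

Lemma cl_vec1 v i : cl_vec v [set i] = v i 0.
Proof.
rewrite cl_vecE (bigD1 i) //= eqxx mulr1 big1 ?addr0 // => j nj.
by rewrite (inj_eq set1_inj) eq_sym (negPf nj) mulr0.
Qed.

Definition dotcv u v := \sum_i u i 0 * v i 0.

Lemma cl_gen_mul i j :
  cl_gen i * cl_gen j + cl_gen j * cl_gen i = - ((i == j)%:R *+ 2)%:A.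
Proof.
have [->|nij] := eqVneq i j.
  by rewrite cl_gen_sqr scaler_nat mulr2n opprD.
by rewrite cl_gen_anticomm // addNr mul0rn scale0r oppr0.
Qed.

Lemma cl_vecM u v :
  cl_vec u * cl_vec v = \sum_i \sum_j (u i 0 * v j 0) *: (cl_gen i * cl_gen j).
Proof.
rewrite mulr_suml; apply: eq_bigr => i _; rewrite mulr_sumr.
by apply: eq_bigr => j _; rewrite -scalerAl -scalerAr scalerA.
Qed.

Lemma cl_vec_anticomm u v :
  cl_vec u * cl_vec v + cl_vec v * cl_vec u = - (dotcv u v *+ 2)%:A.
Proof.
rewrite !cl_vecM [X in _ + X]exchange_big -big_split /=.
rewrite -sumrMnl scaler_suml -sumrN; apply: eq_bigr => i _.
rewrite -big_split (bigD1 i) //= [X in _ + X]big1 => [|j nji].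
  rewrite addr0 [v i 0 * _]mulrC -scalerDr cl_gen_mul eqxx.
  by rewrite scalerN scalerA mulrnAr mulr1.
rewrite [v j 0 * _]mulrC -scalerDr cl_gen_mul eq_sym (negPf nji).
by rewrite mul0rn scale0r oppr0 scaler0.
Qed.


Lemma cl_vec_is_linear : linear cl_vec.
Proof.
move=> a u v; rewrite /cl_vec scaler_sumr -big_split; apply: eq_bigr => i _.
by rewrite !mxE scalerA scalerDl.
Qed.
HB.instance Definition _ :=
  GRing.isLinear.Build R 'cV[R]_n (clifford R n) _ cl_vec cl_vec_is_linear.

Lemma cl_vec_delta i : cl_vec (delta_mx i 0) = cl_gen i.
Proof.
rewrite /cl_vec (bigD1 i) //= big1 => [|j nj].
  by rewrite mxE !eqxx scale1r addr0.
by rewrite mxE (negPf nj) scale0r.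
Qed.

Definition unit_vector v := dotcv v v == 1.

(* The covering map lambda_n : Spin(n) -> SO(n): the matrix of the            *)
(* endomorphism v |-> x v (cl_conj x) of R^n. Here column j is read off from  *)
(* the coordinates of x e_j (cl_conj x) on the e_i.                           *)
Definition cl_lambda x : 'M[R]_n :=
  \matrix_(i, j) (x * cl_gen j * cl_conj x) [set i].

Definition spin x : Prop :=
  exists us : seq 'cV[R]_n,
    [/\ ~~ odd (size us), all unit_vector us & x = \prod_(u <- us) cl_vec u].

Lemma spin1 : spin 1.
Proof. by exists [::]; rewrite big_nil. Qed.

Lemma spinM x y : spin x -> spin y -> spin (x * y).
Proof.
move=> [us [eu uu ->]] [vs [ev uv ->]]; exists (us ++ vs).
by rewrite size_cat oddD (negPf eu) (negPf ev) all_cat uu uv big_cat.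
Qed.

End Clifford.

Arguments cl_basis {R n}.
Arguments cl_gen {R n}.

Section SpinReal.
Variables (R : realType) (n : nat).
Implicit Types (x y : clifford R n) (u v : 'cV[R]_n).

Lemma cl_vec_sqr u : cl_vec u * cl_vec u = - (dotcv u u)%:A.
Proof.
have := cl_vec_anticomm u u; rewrite -mulr2n -scaler_nat => E.
apply: (@scalerI _ _ (2 : R)); first by rewrite pnatr_eq0.
by rewrite E scalerN scalerA mulr_natl.
Qed.

Lemma spin_conjr x : spin x -> x * cl_conj x = 1.
Proof.
move=> [us [_ uu ->]]; elim: us uu => [|u us IH] /=.
  by rewrite big_nil cl_conj1 mulr1.
case/andP => /eqP uu /IH {}IH; rewrite big_cons cl_conjM.
rewrite -mulrA [X in _ * X]mulrA IH mul1r cl_conj_vec mulrN cl_vec_sqr uu.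
by rewrite scale1r opprK.
Qed.

Lemma spin_conjl x : spin x -> cl_conj x * x = 1.
Proof.
move=> [us [_ uu ->]]; elim/last_ind: us uu => [|us u IH] /=.
  by rewrite big_nil cl_conj1 mulr1.
rewrite all_rcons -cats1 big_cat big_seq1 /= => /andP[/eqP uu /IH {}IH].
rewrite cl_conjM -mulrA [X in _ * X]mulrA IH mul1r cl_conj_vec mulNr.
by rewrite cl_vec_sqr uu scale1r opprK.
Qed.

Lemma cl_lambda_vec x v :
  spin x -> x * cl_vec v * cl_conj x = cl_vec (cl_lambda x *m v).
Proof.
move=> [us [_ uu ->]].
have refl u w : unit_vector u ->
    exists w', cl_vec u * cl_vec w * cl_conj (cl_vec u) = cl_vec w'.
  move=> /eqP u1; exists ((dotcv u w *+ 2) *: u - w).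
  rewrite cl_conj_vec mulrN.
  have E : cl_vec u * cl_vec w = - (dotcv u w *+ 2)%:A - cl_vec w * cl_vec u.
    by rewrite -cl_vec_anticomm addrK.
  rewrite E mulrBl mulNr -scalerAl mul1r -mulrA cl_vec_sqr u1 scale1r mulrN1.
  by rewrite opprK opprD opprK linearB linearZ.
have closed w : exists w',
    \prod_(u <- us) cl_vec u * cl_vec w * cl_conj (\prod_(u <- us) cl_vec u)
      = cl_vec w'.
  elim: us uu => [|u us IH] /=.
    by exists w; rewrite big_nil cl_conj1 mulr1 mul1r.
  case/andP => u1 /IH [w1 E1]; have [w2 E2] := refl u w1 u1; exists w2.
  by rewrite big_cons cl_conjM -E2 -E1 !mulrA.
move: (\prod_(u <- us) _) closed => {us uu} x closed.
have onbasis j : x * cl_gen j * cl_conj x = cl_vec (col j (cl_lambda x)).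
  rewrite -cl_vec_delta; have [w E] := closed (delta_mx j 0).
  rewrite E; congr cl_vec; apply/colP => i.
  by rewrite !mxE -cl_vec_delta E cl_vec1.
rewrite {1}/cl_vec mulr_sumr mulr_suml.
under eq_bigr do rewrite -scalerAr -scalerAl onbasis -linearZ.
rewrite -linear_sum; congr cl_vec; apply/colP => i.
by rewrite summxE mxE; apply: eq_bigr => j _; rewrite !mxE mulrC.
Qed.
End SpinReal.

(******************************************************************************)
(* Isom(R^n) = O(n) |x R^n, where (B, b) acts by v |-> B v + b.               *)
(******************************************************************************)

Record isom (R : realType) (n : nat) := Isom {
  isom_val : 'M[R]_n * 'cV[R]_n;
  _ : isom_val.1 *m isom_val.1^T == 1%:M }.

HB.instance Definition _ R n := [isSub for @isom_val R n].
HB.instance Definition _ R n := [Choice of isom R n by <:].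

Section IsomGroup.
Variables (R : realType) (n : nat).
Implicit Types g h : isom R n.

Definition rot g : 'M[R]_n := (isom_val g).1.
Definition trans g : 'cV[R]_n := (isom_val g).2.

Lemma rotK g : rot g *m (rot g)^T = 1%:M.
Proof. by case: g => b P; exact/eqP. Qed.

Lemma rotTK g : (rot g)^T *m rot g = 1%:M.
Proof. exact/mulmx1C/rotK. Qed.

Lemma isomP g h : rot g = rot h -> trans g = trans h -> g = h.
Proof.
move=> er et; apply: val_inj => /=.
rewrite [isom_val g]surjective_pairing [isom_val h]surjective_pairing.
by congr pair.
Qed.

Fact isom1_subproof : (1%:M : 'M[R]_n) *m (1%:M)^T == 1%:M.
Proof. by rewrite trmx1 mul1mx. Qed.

Fact isomM_subproof g h : (rot g *m rot h) *m (rot g *m rot h)^T == 1%:M.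
Proof. by rewrite trmx_mul mulmxA -(mulmxA (rot g)) rotK mulmx1 rotK. Qed.

Fact isomV_subproof g : (rot g)^T *m (rot g)^T^T == 1%:M.
Proof. by rewrite trmxK rotTK. Qed.

Definition isom_one : isom R n := @Isom R n (1%:M, 0) isom1_subproof.
Definition isom_mul g h : isom R n :=
  @Isom R n (rot g *m rot h, rot g *m trans h + trans g) (isomM_subproof g h).
Definition isom_inv g : isom R n :=
  @Isom R n ((rot g)^T, - ((rot g)^T *m trans g)) (isomV_subproof g).

Fact isom_mulA : associative isom_mul.
Proof.
move=> g h k; apply: isomP; rewrite /rot /trans /= -/(rot _) -/(trans _).
  by rewrite mulmxA.
by rewrite mulmxDr mulmxA addrA.
Qed.

Fact isom_mul1g : left_id isom_one isom_mul.
Proof.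
by move=> g; apply: isomP; rewrite /rot /trans /= mul1mx ?addr0.
Qed.

Fact isom_mulg1 : right_id isom_one isom_mul.
Proof.
by move=> g; apply: isomP; rewrite /rot /trans /= ?mulmx1 // mulmx0 add0r.
Qed.

Fact isom_mulVg : left_inverse isom_one isom_inv isom_mul.
Proof.
move=> g; apply: isomP; rewrite /rot /trans /= -/(rot _) -/(trans _).
  exact: rotTK.
by rewrite subrr.
Qed.

Fact isom_mulgV : right_inverse isom_one isom_inv isom_mul.
Proof.
move=> g; apply: isomP; rewrite /rot /trans /= -/(rot _) -/(trans _).
  exact: rotK.
by rewrite mulmxN mulmxA rotK mul1mx addNr.
Qed.

HB.instance Definition _ := isGroup.Build (isom R n)
  isom_mulA isom_mul1g isom_mulg1 isom_mulVg isom_mulgV.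
End IsomGroup.

Inductive generated (gT : groupType) (I : Type) (s : I -> gT) : gT -> Prop :=
| generated_gen i : generated s (s i)
| generated1 : generated s 1%g
| generatedM g h : generated s g -> generated s h -> generated s (g * h)%g
| generatedV g : generated s g -> generated s (g^-1)%g.

(* A flat manifold R^n / Gamma is represented by Gamma : isom R n -> Prop.     *)

Section Flat.
Variables (R : realType) (n : nat) (Gamma : isom R n -> Prop).

Definition orientable := forall g, Gamma g -> \det (rot g) = 1.

(* An oriented flat manifold R^n / Gamma has a Spin-structure iff its holonomy *)
(* Gamma -> SO(n) lifts to a homomorphism Gamma -> Spin(n). Only the values   *)
(* of epsilon on Gamma matter.                                                *)
Definition has_spin_structure :=
  exists epsilon : isom R n -> clifford R n,
    [/\ forall g, Gamma g -> spin (epsilon g),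
        forall g h, Gamma g -> Gamma h ->
          epsilon (g * h)%g = epsilon g * epsilon h
      & forall g, Gamma g -> cl_lambda (epsilon g) = rot g].
End Flat.

Section Bott.
Variables (R : realType) (n : nat).
Implicit Types A : 'M[bool]_n.

Definition strictly_upper_triangular A := forall r s : 'I_n, A r s -> (r < s)%N.

Definition nonzero_row A (r : 'I_n) := exists s, A r s.

Fact bott_gen_subproof A (r : 'I_n) :
  let D := diag_mx (\row_s (-1) ^+ A r s) : 'M[R]_n in D *m D^T == 1%:M.
Proof.
rewrite /= tr_diag_mx mulmx_diag -diag_const_mx; apply/eqP; congr diag_mx.
by apply/rowP => s; rewrite !mxE -expr2 sqrr_sign.
Qed.

Definition bott_gen A (r : 'I_n) : isom R n :=
  @Isom R n (diag_mx (\row_s (-1) ^+ A r s), 2^-1 *: delta_mx r 0)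
    (bott_gen_subproof A r).

(* Indices are 0-based: r : 'I_n stands for the usual row or column index   *)
(* r.+1 in {1, ..., n}.                                                      *)
Definition index_in (a b : nat) (r : 'I_n) : bool := (a <= r.+1 <= b)%N.

Definition bott_group A : isom R n -> Prop := generated (bott_gen A).
End Bott.

Arguments bott_gen R {n} A r.
Arguments bott_group R {n} A _.

(* Main.v *)
Require Import Defs.
From mathcomp Require Import all_boot all_order all_algebra.
From mathcomp Require Import reals.
From mathcomp Require Import zify.

Set Implicit Arguments.
Unset Strict Implicit.
Unset Printing Implicit Defensive.

(* Let S_r be the support of row r. A lift of s_r to Spin(n) is a multiple of
   e_(S_r), hence central unless r is i or j, so only the relation between s_i
   and s_j matters: s_i s_j = s_j^(-1) s_i if a_ij = 1, and s_i s_j = s_j s_i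
   otherwise. As |S_i| and |S_j| are even, e_(S_i) e_(S_j) is
   (-1)^|S_i cap S_j| e_(S_j) e_(S_i), while the inverse of e_(S_j) is
   (-1)^(|S_j|/2) e_(S_j). So a Spin-structure forces |S_i cap S_j| to be
   congruent mod 2 to a_ij |S_j|/2. Conversely, if this holds and a_ij = 1,
   then g |-> e_(S_j)^b e_(S_i)^a is a lift, where a/2 and b/2 are the
   coordinates i and j of the translation part of g: these define a homomorphism
   from the Bott group to the group Z |x Z of the Klein bottle. In both parts of
   the theorem |S_i cap S_j| = 2l + 1 is odd; in part 1, |S_j|/2 = l + m + 1,
   and in part 2, a_ij = 0 because j lies to the left of S_j. *)

Import Order.TTheory GRing.Theory Num.Theory.
Local Open Scope ring_scope.

(* [finset] and [seq] reuse these two names. *)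
Local Notation setSD := Defs.setSD.
Local Notation rot := Defs.rot.

(** * Signs and parity in the Clifford algebra *)

Lemma odd_card_setSD (T : finType) (A B : {set T}) :
  odd #|setSD A B| = odd #|A| (+) odd #|B|.
Proof.
rewrite /Defs.setSD cardsU -(cardsID B A) -(cardsID A B) [B :&: A]setIC.
rewrite (_ : (A :\: B) :&: (B :\: A) = set0) ?cards0 ?subn0 ?oddD.
  by case: (odd #|A :&: B|); case: (odd _); case: (odd _).
by apply/setP => x; rewrite !inE; case: (x \in A); rewrite ?andbF.
Qed.

Section Signs.
Variables (R : comNzRingType) (n : nat).
Implicit Types S T : {set 'I_n}.

(** A pair (s, t) with s != t, s in S and t in T contributes -1 to exactly one of the two signs; a
    pair with s = t contributes to both, whence the second term of the exponent. *)
Lemma cl_signC S T :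
  cl_sign R S T * cl_sign R T S = (-1) ^+ (#|S| * #|T| + #|S :&: T|).
Proof.
rewrite !cl_signE [X in _ * X]exchange_big -big_split /=.
under eq_bigr do [rewrite -big_split /=; under eq_bigr do rewrite -exprD].
under eq_bigr do rewrite prodrXr.
rewrite prodrXr; congr (_ ^+ _).
rewrite -!sum1_card big_distrl [X in (_ + X)%N]big_mkcond.
rewrite [X in (X + _)%N]big_mkcond.
rewrite -big_split; apply: eq_bigr => s _ /=; rewrite inE mul1n.
case: (s \in S) => /=; last by rewrite big1 // => t _; rewrite andbF.
have -> : (if s \in T then 1 else 0)%N = (\sum_(t | t == s) (t \in T))%N.
  by rewrite big_pred1_eq; case: (s \in T).
rewrite [in RHS]big_mkcond [X in (_ + X)%N]big_mkcond -big_split.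
apply: eq_bigr => t _ /=; case: (t \in T); last by case: eqP.
have [->|nts] := eqVneq t s; first by rewrite leqnn.
by case: ltngtP => // /val_inj e; rewrite e eqxx in nts.
Qed.

(** The sign counts the pairs t <= s in S; taking one element out of S removes |S| of them. *)
Lemma cl_sign_diag S : cl_sign R S S = (-1) ^+ 'C(#|S|.+1, 2).
Proof.
move cS: #|S| => c; elim: c S cS => [|c IH] S cS.
  by rewrite (cards0_eq cS) cl_sign0l bin_small.
have /card_gt0P[s sS] : (0 < #|S|)%N by rewrite cS.
have cS' : #|S :\ s| = c by move: cS; rewrite (cardsD1 s) sS => -[].
have -> : S = setSD [set s] (S :\ s).
  apply/setP => t; rewrite in_setSD !inE.
  by case: eqP => [->|]; rewrite ?sS //=; case: (_ \in S).
rewrite cl_signDl !cl_signDr cl_sign1 leqnn (IH _ cS') -mulrA [X in _ * X]mulrA.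
rewrite cl_signC cards1 cS'.
have -> : [set s] :&: (S :\ s) = set0.
  by apply/setP => t; rewrite !inE; case: eqP.
rewrite cards0 addn0 mul1n -!exprD !binS !bin1 bin0.
by rewrite addnA addnC [(c + 1)%N]addnC.
Qed.


Lemma cl_sign_set1C S i :
  cl_sign R S [set i] * cl_sign R [set i] S = (-1) ^+ (#|S| + (i \in S))%N.
Proof.
rewrite cl_signC cards1 muln1; congr ((-1) ^+ (_ + _)).
rewrite (_ : S :&: [set i] = if i \in S then [set i] else set0).
  by case: (i \in S); rewrite ?cards1 ?cards0.
apply/setP => t; rewrite !inE; case: eqP => [->|] /=.
  by case: (i \in S); rewrite !inE ?eqxx ?andbT ?andbF.
by rewrite andbF; case: (i \in S); rewrite !inE //; case: eqP.
Qed.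

Lemma cl_basis_exp4 S : (cl_basis S : clifford R n) ^+ 4 = 1.
Proof.
rewrite (exprM _ 2 2) [cl_basis S ^+ 2]expr2 cl_basisM setSDv exprZn.
by rewrite expr1n expr2 cl_sign_sqr scale1r.
Qed.

Lemma cl_basis_exp3 S : (cl_basis S : clifford R n) ^+ 3 = cl_conj (cl_basis S).
Proof.
rewrite exprS expr2 cl_basisM setSDv -scalerAr mulr1 cl_conj_basis //.
Qed.

Lemma cl_basis_conjgen S i :
  cl_basis S * cl_gen i * cl_conj (cl_basis S)
  = (-1) ^+ (#|S| + (i \in S))%N *: cl_gen i :> clifford R n.
Proof.
rewrite cl_conj_basis -scalerAr /cl_gen cl_basisM -scalerAl cl_basisM.
rewrite [X in cl_basis X]setSDC setSDK cl_signDl !scalerA.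
by rewrite mulrACA cl_sign_sqr mul1r cl_sign_set1C.
Qed.

(** Conjugation by e_S multiplies e_i by (-1)^(|S| + [i in S]), and |S| is even. *)
Lemma cl_lambda_basis S : ~~ odd #|S| ->
  cl_lambda (cl_basis S) = diag_mx (\row_s (-1) ^+ (s \in S)) :> 'M[R]_n.
Proof.
move=> evenS; apply/matrixP => i j; rewrite !mxE cl_basis_conjgen !ffunE.
rewrite -signr_odd oddD (negPf evenS) /= oddb /GRing.scale /=.
by rewrite (inj_eq set1_inj); case: eqP => [->|]; rewrite ?mulr1 ?mulr0.
Qed.

Lemma cl_basis_prod_vec S : exists us : seq 'cV[R]_n,
  [/\ size us = #|S|, all (@unit_vector R n) us
    & cl_basis S = \prod_(u <- us) cl_vec u].
Proof.
move cS: #|S| => c; elim: c S cS => [|c IH] S cS.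
  by exists [::]; rewrite (cards0_eq cS) big_nil.
have /card_gt0P[s sS] : (0 < #|S|)%N by rewrite cS.
have cS' : #|S :\ s| = c by move: cS; rewrite (cardsD1 s) sS => -[].
have [us [us_c us1 usE]] := IH _ cS'.
(* The unit vector e_s or -e_s absorbs the sign of the product of e_s and e_(S minus s). *)
pose e := cl_sign R [set s] (S :\ s).
exists (e *: delta_mx s 0 :: us); split => /=; first by rewrite us_c.
  rewrite us1 andbT /unit_vector /dotcv (bigD1 s) //= big1 => [|t nts].
    by rewrite !mxE !eqxx mulr1 cl_sign_sqr addr0.
  by rewrite !mxE (negPf nts) mulr0 mul0r.
rewrite big_cons -usE linearZ /= cl_vec_delta -scalerAl cl_basisM scalerA.
rewrite cl_sign_sqr scale1r; congr cl_basis.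
apply/setP => t; rewrite in_setSD !inE.
by case: eqP => [->|]; rewrite ?sS //=; case: (_ \in S).
Qed.

Lemma spin_basis S : ~~ odd #|S| -> spin (cl_basis S : clifford R n).
Proof. by have [us [<- us1 ->]] := cl_basis_prod_vec S => us2; exists us. Qed.

(** Multiplication by a vector reverses the Z/2-grading of the Clifford algebra. *)
Lemma prod_vec_parity (us : seq 'cV[R]_n) S :
  odd #|S| != odd (size us) -> (\prod_(u <- us) cl_vec u) S = 0.
Proof.
elim: us S => [|u us IH] S /= oS.
  rewrite big_nil ffunE; case: eqP => // S0.
  by rewrite S0 cards0 in oS.
rewrite big_cons cl_mulrE big1 // => T _; rewrite cl_vecE.
have [/existsP[i /eqP->]|noT] := boolP [exists i, T == [set i]].
  rewrite IH ?mulr0 // odd_card_setSD cards1; move: oS.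
  by case: (odd _); case: (odd _).
rewrite big1 ?mulr0 ?mul0r // => i _.
by move: noT; rewrite negb_exists => /forallP/(_ i)/negPf->; rewrite mulr0.
Qed.

Lemma spin_even (x : clifford R n) S : spin x -> odd #|S| -> x S = 0.
Proof.
by move=> [us [us_even _ ->]] oS; rewrite prod_vec_parity // oS (negPf us_even).
Qed.

End Signs.

(* The power [x ^ a], provided that [x ^+ 4 = 1]. *)
Definition zexp (T : pzRingType) (x : T) (a : int) := x ^+ `|(a %% 4)%Z|%N.

(** * Integer powers of elements whose fourth power is 1 *)

Section Powers.
Variable T : pzRingType.
Implicit Types (x y : T) (a b : int).

Lemma zexp_mod x a (k : nat) : x ^+ 4 = 1 -> (a = k %[mod 4])%Z ->
  zexp x a = x ^+ k.
Proof.
by move=> x4 e; rewrite /zexp e modz_nat /= (expr_mod _ x4).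
Qed.

Lemma zexp0 x : zexp x 0 = 1. Proof. by rewrite /zexp mod0z. Qed.
Lemma zexp1 x : zexp x 1 = x. Proof. by []. Qed.

Lemma zexpD x a b : x ^+ 4 = 1 -> zexp x (a + b) = zexp x a * zexp x b.
Proof.
move=> x4; rewrite -exprD; apply: zexp_mod => //.
by rewrite PoszD !gez0_abs ?modz_ge0 // modzDm.
Qed.

Lemma zexpN x a : x ^+ 4 = 1 -> zexp x (- a) = zexp (x ^+ 3) a.
Proof.
move=> x4; rewrite [RHS]/zexp -exprM; apply: zexp_mod => //.
rewrite PoszM !gez0_abs ?modz_ge0 // modzMmr.
by apply/eqP; rewrite eqz_mod_dvd -mulN1r -mulrBl dvdz_mulr.
Qed.

(** The last hypothesis says that x y x^(-1) = y^(-1), so conjugation by x^a raises y to the power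
    (-1)^a, which is the integer [zexp (-1) a]. *)
Lemma zexp_comm x y a b : x ^+ 4 = 1 -> y ^+ 4 = 1 -> x * y = y ^+ 3 * x ->
  zexp x a * zexp y b = zexp y (zexp (-1) a * b) * zexp x a.
Proof.
move=> x4 y4 xy; have comm1 c : x * zexp y c = zexp y (- c) * x.
  rewrite zexpN // /zexp; elim: `|_|%N => [|k IH]; first by rewrite mulr1 mul1r.
  by rewrite exprSr mulrA IH -mulrA xy mulrA -exprSr.
rewrite /zexp; elim: `|_|%N b => [|k IH] b.
  by rewrite !expr0 !mul1r mulr1.
rewrite exprSr -mulrA comm1 mulrA IH -mulrA -exprSr [(-1) ^+ k.+1]exprSr.
by rewrite mulrN1 mulNr mulrN.
Qed.

(** The exponents multiply as in the Klein bottle group: (b, a)(b', a') = (b + (-1)^a b', a +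
    a'). *)
Lemma zexp_semidirect x y a b a' b' :
  x ^+ 4 = 1 -> y ^+ 4 = 1 -> x * y = y ^+ 3 * x ->
  zexp y b * zexp x a * (zexp y b' * zexp x a')
  = zexp y (b + zexp (-1) a * b') * zexp x (a + a').
Proof.
move=> x4 y4 xy; rewrite !zexpD // !mulrA; congr (_ * _).
by rewrite -!mulrA zexp_comm.
Qed.
End Powers.

(** * Elements of Spin(n) above diagonal matrices *)

Section SpinDiagonal.
Variables (R : realType) (n : nat).
Implicit Types (x y : clifford R n) (S : {set 'I_n}).

Lemma cl_lambdaM x y : spin x -> spin y ->
  cl_lambda (x * y) = cl_lambda x *m cl_lambda y.
Proof.
move=> sx sy; apply/matrixP => i j; rewrite mxE cl_conjM !mulrA.
rewrite -[x * y * _]mulrA -[x * _ * cl_conj y]mulrA -cl_vec_delta.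
rewrite cl_lambda_vec // cl_lambda_vec // cl_vec1 mulmxA -colE mxE //.
Qed.

Lemma cl_lambda1 : cl_lambda (1 : clifford R n) = 1%:M.
Proof.
apply/matrixP => i j; rewrite !mxE cl_conj1 mulr1 mul1r ffunE.
by rewrite (inj_eq set1_inj).
Qed.

Lemma spinX x k : spin x -> spin (x ^+ k).
Proof.
move=> sx; elim: k => [|k IH]; first exact: spin1.
by rewrite exprS; apply: spinM.
Qed.

Lemma cl_lambdaX x k : spin x -> cl_lambda (x ^+ k) = cl_lambda x ^+ k.
Proof.
move=> sx; elim: k => [|k IH]; first exact: cl_lambda1.
by rewrite exprS cl_lambdaM ?IH ?exprS //; apply: spinX.
Qed.

(* Up to a scalar, [cl_basis S] is the only even element that commutes with
   [cl_gen t] for [t \notin S] and anticommutes with it for [t \in S]. *)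
Lemma spin_diag x S : ~~ odd #|S| -> spin x ->
    cl_lambda x = diag_mx (\row_s (-1) ^+ (s \in S)) ->
  exists2 c : R, c != 0 & x = c *: cl_basis S.
Proof.
move=> evenS sx lx.
have comm t : x * cl_gen t = (-1) ^+ (t \in S) *: (cl_gen t * x).
  rewrite -[LHS]mulr1 -(spin_conjl sx) mulrA -cl_vec_delta cl_lambda_vec // lx.
  rewrite scalerAl -linearZ; congr (cl_vec _ * x).
  apply/colP => s; rewrite mul_diag_mx !mxE.
  by case: eqP => [->|]; rewrite ?mulr0.
have xS : x = x S *: cl_basis S.
  apply/ffunP => T; rewrite !ffunE /GRing.scale /=.
  have [->|nTS] := eqVneq T S; first by rewrite mulr1.
  rewrite mulr0; have [oT|eT] := boolP (odd #|T|); first exact: spin_even oT.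
  (* Where T and S differ at t, comparing the coefficients of e_(T + {t}) (symmetric difference) on
     both sides of [comm t] gives x_T = - x_T. *)
  have /existsP[t] : [exists t, (t \in T) != (t \in S)].
    apply: contraR nTS; rewrite negb_exists => /forallP sTS.
    by apply/eqP/setP => t; have := sTS t; rewrite negbK => /eqP.
  have tK : setSD [set t] (setSD T [set t]) = T.
    by rewrite [setSD T _]setSDC setSDK.
  move=> ntTS.
  have := congr1 (fun z : clifford R n => z (setSD T [set t])) (comm t).
  rewrite /= [RHS]ffunE !cl_mulrE (bigD1 T) //= setSDK.
  rewrite big1 => [|U nUT]; last first.
    rewrite [setSD U _]setSDC ffunE setSD_eq [X in _ == X]setSDC tK.
    by rewrite (negPf nUT) mulr0.
  rewrite (bigD1 [set t]) //= big1 => [|U nUt]; last first.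
    by rewrite ffunE (negPf nUt) mulr0 mul0r.
  rewrite tK !ffunE eqxx !addr0 !mulr1.
  rewrite /GRing.scale /= => /(congr1 ( *%R (cl_sign R [set t] T))).
  rewrite mulrA [in RHS]mulrCA [X in _ = _ * X]mulrA cl_sign_sqr mul1r.
  rewrite [X in X * _ = _]mulrC cl_sign_set1C -signr_odd oddD (negPf eT) /= oddb.
  case: (t \in T) ntTS; case: (t \in S) => //= _.
    by rewrite expr1 mulN1r mul1r => /eqP; rewrite eqNr => /eqP.
  by rewrite expr1 mulN1r mul1r => /esym/eqP; rewrite eqNr => /eqP.
exists (x S) => //; apply/eqP => xS0; move/eqP: (spin_conjr sx).
by rewrite xS xS0 scale0r mul0r eq_sym oner_eq0.
Qed.
Lemma cl_lambda_zexp_basis S a (v : 'cV[R]_n) r : ~~ odd #|S| ->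
  (cl_lambda (zexp (cl_basis S) a) *m v) r 0
  = zexp ((-1) ^+ (r \in S)) a * v r 0.
Proof.
move=> evenS; rewrite cl_lambdaX; last exact: spin_basis.
rewrite cl_lambda_basis // /zexp; elim: `|_|%N v => [|k IH] v.
  by rewrite mul1mx mul1r.
by rewrite !exprSr -[_ * diag_mx _]/(_ *m _) -mulmxA IH mul_diag_mx !mxE mulrA.
Qed.
End SpinDiagonal.

(** * The Bott group, and the sign condition forced by a Spin-structure *)

Section BottGroup.
Variables (R : realType) (n : nat) (A : 'M[bool]_n) (i j : 'I_n).
Hypothesis A_upper : strictly_upper_triangular A.
Hypothesis lt_ij : (i < j)%N.

Definition row_support (r : 'I_n) : {set 'I_n} := [set s | A r s].

Hypothesis even_i : ~~ odd #|row_support i|.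
Hypothesis even_j : ~~ odd #|row_support j|.

Lemma rot_bott_gen r :
  rot (bott_gen R A r) = diag_mx (\row_s (-1) ^+ (s \in row_support r)).
Proof. by congr diag_mx; apply/rowP => s; rewrite !mxE inE. Qed.

Lemma strictly_upper_geF (r s : 'I_n) : (s <= r)%N -> A r s = false.
Proof. by move=> le_sr; apply: contraTF le_sr => /A_upper; rewrite -ltnNge. Qed.

Lemma rot_trans_bott_gen r t :
  rot (bott_gen R A r) *m trans (bott_gen R A t)
  = (-1) ^+ A r t *: trans (bott_gen R A t).
Proof.
apply/colP => s; rewrite rot_bott_gen mul_diag_mx !mxE inE.
by case: eqP => [->|]; rewrite ?mulr0.
Qed.

(** The linear parts are diagonal, so they commute. As [A j i] vanishes, s_j fixes e_i, while s_i
    multiplies e_j by (-1)^(a_ij); as [A j j] vanishes, inverting s_j just negates its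
    translation. *)
Lemma bott_genC : let s := bott_gen R A in
  (s i * s j = (if A i j then (s j)^-1 else s j) * s i)%g.
Proof.
move=> s; have rT : (rot (s j))^T = rot (s j) by apply: tr_diag_mx.
have tV : trans (s j)^-1%g = - trans (s j).
  transitivity (- ((rot (s j))^T *m trans (s j))) => //.
  by rewrite rT rot_trans_bott_gen strictly_upper_geF // scale1r.
apply: isomP.
  transitivity (rot (s j) *m rot (s i)); first exact: diag_mx_comm.
  by congr (_ *m _); case: (A i j).
transitivity (rot (s j) *m trans (s i) + (-1) ^+ A i j *: trans (s j)).
  rewrite rot_trans_bott_gen (strictly_upper_geF (ltnW lt_ij)) scale1r addrC.
  by rewrite -rot_trans_bott_gen.
congr (_ *m _ + _); first by case: (A i j).
by case: (A i j); rewrite ?tV ?expr1 ?scaleN1r ?scale1r.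
Qed.

(** The lift is applied to the relation [bott_genC]. Since s_i and s_j lift to non-zero multiples of
    e_(S_i) and e_(S_j), the scalars cancel and only signs remain. *)
Lemma spin_structure_sign : has_spin_structure (bott_group R A) ->
  let S := row_support in
  cl_sign R (S i) (S j) * cl_sign R (S j) (S i)
  = if A i j then cl_sign R (S j) (S j) else 1.
Proof.
move=> [f [f_spin fM f_lift]] S; pose s := bott_gen R A.
have G r : bott_group R A (s r) by apply: generated_gen.
have f_gen r : ~~ odd #|S r| ->
    exists2 c : R, c != 0 & f (s r) = c *: cl_basis (S r).
  move=> Sr; apply: spin_diag => //; first exact: f_spin.
  by rewrite f_lift ?rot_bott_gen.
(* The image of 1 is idempotent and invertible. *)
have f1 : f 1%g = 1.
  have G1 : bott_group R A 1%g by apply: generated1.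
  have := congr1 ( *%R (cl_conj (f 1%g))) (fM _ _ G1 G1).
  by rewrite mulg1 mulrA (spin_conjl (f_spin _ G1)) mul1r => <-.
have fV g : bott_group R A g -> f g^-1%g = cl_conj (f g).
  move=> Gg; have GV : bott_group R A g^-1%g by apply: generatedV.
  rewrite -[LHS]mul1r -(spin_conjl (f_spin _ Gg)) -mulrA -fM // mulgV f1.
  exact: mulr1.
have [c c0 fi] := f_gen i even_i.
have [d d0 fj] := f_gen j even_j.
set e := RHS.
have fe : f (if A i j then (s j)^-1 else s j)%g = e *: f (s j).
  rewrite /e; case: (A i j); last by rewrite scale1r.
  by rewrite fV // fj cl_conjZ cl_conj_basis !scalerA mulrC.
have Ge : bott_group R A (if A i j then (s j)^-1 else s j)%g.
  by case: (A i j); rewrite //; apply/generatedV/G.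
(* Both sides are multiples of this one basis element. *)
pose coord (x : clifford R n) := x (setSD (S i) (S j)).
have := congr1 coord (congr1 f bott_genC); rewrite /coord.
rewrite !fM // fe fi fj -!(scalerAl, scalerAr) !cl_basisM [setSD (S j) _]setSDC.
rewrite !ffunE /GRing.scale /= eqxx !mulr1.
rewrite [in LHS]mulrA [d * _]mulrA [in RHS]mulrCA [d * c]mulrC.
move=> /(mulfI (mulf_neq0 c0 d0))->.
by rewrite -mulrA cl_sign_sqr mulr1.
Qed.

(** * Construction of a Spin-structure when a_ij = 1 *)

Hypothesis A_rows : forall r s, A r s -> r = i \/ r = j.
Hypothesis Aij : A i j.
Hypothesis sign_ij : cl_sign R (row_support i) (row_support j)
  * cl_sign R (row_support j) (row_support i)
  = cl_sign R (row_support j) (row_support j).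

Let x : clifford R n := cl_basis (row_support i).
Let y : clifford R n := cl_basis (row_support j).
Let lift a b := zexp y b * zexp x a.

(** By [sign_ij], x y = y^3 x, where y^3 = [cl_conj y] is the inverse of y. *)
Let liftM a b a' b' :
  lift a b * lift a' b' = lift (a + a') (b + zexp (-1) a * b').
Proof.
apply: zexp_semidirect; rewrite ?cl_basis_exp4 // cl_basis_exp3 cl_conj_basis.
rewrite -scalerAl !cl_basisM setSDC scalerA; congr (_ *: _).
by rewrite -sign_ij -mulrA cl_sign_sqr mulr1.
Qed.

Let spin_lift a b : spin (lift a b).
Proof. by apply: spinM; apply: spinX; apply: spin_basis. Qed.

Let lift_act a b (v : 'cV[R]_n) r : (cl_lambda (lift a b) *m v) r 0
  = zexp ((-1) ^+ A j r) b * (zexp ((-1) ^+ A i r) a * v r 0).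
Proof.
rewrite cl_lambdaM; try by apply: spinX; apply: spin_basis.
by rewrite -mulmxA !cl_lambda_zexp_basis // !inE.
Qed.

Let lift_act_i a b (v : 'cV[R]_n) : (cl_lambda (lift a b) *m v) i 0 = v i 0.
Proof.
rewrite lift_act (strictly_upper_geF (ltnW lt_ij)) strictly_upper_geF //.
by rewrite /zexp !expr1n !mul1r.
Qed.

Let lift_act_j a b (v : 'cV[R]_n) :
  (cl_lambda (lift a b) *m v) j 0 = zexp (-1) a * v j 0.
Proof. by rewrite lift_act strictly_upper_geF // Aij /zexp expr1n mul1r. Qed.

(** The rotation is recorded together with the two translation coordinates because it governs how
    they compose. *)
Let coords g a b := [/\ rot g = cl_lambda (lift a b),
  trans g i 0 = a%:~R / 2 & trans g j 0 = b%:~R / 2].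

Let coordsM g h a b a' b' : coords g a b -> coords h a' b' ->
  coords (g * h)%g (a + a') (b + zexp (-1) a * b').
Proof.
move=> [rg gi gj] [rh hi hj]; split.
- by rewrite -liftM cl_lambdaM // -rg -rh.
- transitivity ((rot g *m trans h) i 0 + trans g i 0); first exact: mxE.
  by rewrite rg lift_act_i gi hi intrD mulrDl addrC.
transitivity ((rot g *m trans h) j 0 + trans g j 0); first exact: mxE.
rewrite rg lift_act_j gj hj intrD mulrDl intrM -mulrA addrC.
by rewrite rmorphXn /= rmorphN1.
Qed.

Let coordsV g a b :
  coords g a b -> coords g^-1%g (- a) (- (zexp (-1) (- a) * b)).
Proof.
move=> [rg gi gj]; set b' := - (_ * b).
(* As [rot g] is orthogonal, a right inverse of it must be its transpose. *)
have rV : (rot g)^T = cl_lambda (lift (- a) b').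
  have VV : zexp (-1) a * zexp (-1) (- a) = 1 :> int by rewrite -zexpD // addrN.
  have : rot g *m cl_lambda (lift (- a) b') = 1%:M.
    rewrite rg -cl_lambdaM // liftM /b' addrN mulrN mulrA VV mul1r addrN.
    by rewrite /lift !zexp0 mulr1 cl_lambda1.
  by move/(congr1 (mulmx (rot g)^T)); rewrite mulmxA rotTK mul1mx mulmx1.
split; first exact: rV.
  transitivity (- ((rot g)^T *m trans g) i 0); first exact: mxE.
  by rewrite rV lift_act_i gi intrN mulNr.
transitivity (- ((rot g)^T *m trans g) j 0); first exact: mxE.
rewrite rV lift_act_j gj intrN intrM mulNr mulrA.
by rewrite rmorphXn /= rmorphN1.
Qed.

Lemma bott_spin_structure : has_spin_structure (bott_group R A).
Proof.
have ex g : bott_group R A g -> exists a b, coords g a b.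
  elim=> {g} [r||g h _ [a [b Cg]] _ [a' [b' Ch]]|g _ [a [b Cg]]].
  - have [->|nri] := eqVneq r i.
      exists 1, 0; split; rewrite ?mxE.
      + by rewrite /lift zexp0 mul1r zexp1 cl_lambda_basis ?rot_bott_gen.
      + by rewrite !eqxx mulr1 mul1r.
      + by rewrite -val_eqE /= gtn_eqF // mulr0 mul0r.
    have [->|nrj] := eqVneq r j.
      exists 0, 1; split; rewrite ?mxE.
      + by rewrite /lift zexp0 mulr1 zexp1 cl_lambda_basis ?rot_bott_gen.
      + by rewrite -val_eqE /= ltn_eqF // mulr0 mul0r.
      + by rewrite !eqxx mulr1 mul1r.
    (* Row r is zero, so s_r is a translation along e_r and lifts to 1. *)
    exists 0, 0; split; rewrite ?mxE.
    + have Sr : row_support r = set0.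
        apply/setP=> s; rewrite !inE; apply: contraNF nri => /A_rows[->|rj] //.
        by rewrite rj eqxx in nrj.
      by rewrite /lift !zexp0 mulr1 rot_bott_gen Sr -cl_lambda_basis ?cards0.
    + by rewrite eq_sym (negPf nri) mulr0 mul0r.
    + by rewrite eq_sym (negPf nrj) mulr0 mul0r.
  - exists 0, 0; split; rewrite ?mul0r ?mxE //.
    by rewrite /lift !zexp0 mulr1 cl_lambda1.
  - by do 2 eexists; apply: coordsM Cg Ch.
  - by do 2 eexists; apply: coordsV Cg.
(* On the Bott group the doubled coordinates are integers, so [Num.floor] recovers a and b exactly;
   it also makes f total. *)
pose f (g : isom R n) :=
  lift (Num.floor (2 * trans g i 0)) (Num.floor (2 * trans g j 0)).
have fE g a b : coords g a b -> f g = lift a b.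
  case=> _ gi gj; rewrite /f gi gj ![2 * (_ / 2)]mulrC.
  by rewrite !divfK ?pnatr_eq0 // !intrKfloor.
exists f; split=> [g _|g h /ex[a [b Cg]] /ex[a' [b' Ch]]|g /ex[a [b Cg]]].
- exact: spin_lift.
- by rewrite (fE _ _ _ Cg) (fE _ _ _ Ch) (fE _ _ _ (coordsM Cg Ch)) liftM.
- by rewrite (fE _ _ _ Cg); case: Cg.
Qed.
End BottGroup.

(** * Cardinalities of the supports, and the parity criterion *)

Lemma card_index_in n a b : (0 < a)%N -> (b <= n)%N ->
  #|[set r : 'I_n | index_in a b r]| = (b.+1 - a)%N.
Proof.
case: a => // a _ le_bn; rewrite subSS -sum1dep_card.
rewrite -(big_mkord (fun r => a < r.+1 <= b)%N (fun=> 1%N)).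
under eq_bigl do rewrite ltnS.
rewrite -big_nat_widen // -(big_nat_widenl _ 0 _ predT) //.
by rewrite sum_nat_const_nat muln1.
Qed.

(** For even |T|, the binomial coefficient of |T| + 1 over 2 is (|T| + 1)(|T|/2), of the parity of
    |T|/2. *)
Lemma spin_sign_odd (R : realType) n (S T : {set 'I_n}) (b : bool) :
    ~~ odd #|S| -> ~~ odd #|T| ->
  (cl_sign R S T * cl_sign R T S = if b then cl_sign R T T else 1)
  <-> odd #|S :&: T| = b && odd #|T|./2.
Proof.
move=> evenS evenT; rewrite cl_signC -signr_odd oddD oddM (negPf evenS) /=.
have -> : (if b then cl_sign R T T else 1) = (-1) ^+ (b && odd #|T|./2) :> R.
  case: b => //=; rewrite cl_sign_diag -signr_odd bin2odd /= ?evenT // oddM /=.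
  by rewrite evenT.
by split=> [/signr_inj|->].
Qed.


Local Close Scope ring_scope.

Theorem theorem3p3 (R : realType) (n : nat) (A : 'M[bool]_n) (i j : 'I_n)
    (k l m i1 : nat)
    (A_upper : strictly_upper_triangular A)
    (lt_ij : (i < j)%N)
    (A_rows : forall r : 'I_n, nonzero_row A r <-> r = i \/ r = j)
    (A_orientable : orientable (bott_group R A))
    (le_n : (i1 + 2 * k + 2 * l + 2 * m + 3 <= n)%N) :
  ((forall r : 'I_n,
      A i r = index_in (i1 + 1) (i1 + 2 * k + 2 * l + 2) r) ->
   (forall s : 'I_n,
      A j s = index_in (i1 + 2 * k + 2) (i1 + 2 * k + 2 * l + 2 * m + 3) s) ->
   (has_spin_structure (bott_group R A) <->
    odd l = odd m /\ index_in (i1 + 1) (i1 + 2 * k + 2) j))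
  /\
  ((forall r : 'I_n,
      A j r = index_in (i1 + 1) (i1 + 2 * k + 2 * l + 2) r) ->
   (forall s : 'I_n,
      A i s = index_in (i1 + 2 * k + 2) (i1 + 2 * k + 2 * l + 2 * m + 3) s) ->
   ~ has_spin_structure (bott_group R A)).
Proof.
have A_rows' r s : A r s -> r = i \/ r = j.
  by move=> Ars; apply/A_rows; exists s.
(* Row p carries the left interval and row q the right one, so that both parts can use this with i
   and j exchanged. *)
have cards p q :
    (forall r, A p r = index_in (i1 + 1) (i1 + 2 * k + 2 * l + 2) r) ->
    (forall s, A q s
       = index_in (i1 + 2 * k + 2) (i1 + 2 * k + 2 * l + 2 * m + 3) s) ->
  [/\ #|row_support A p| = (k + l + 1).*2, #|row_support A q| = (l + m + 1).*2
    & #|row_support A p :&: row_support A q| = l.*2.+1].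
  move=> Ap Aq; split.
  - rewrite (eq_card (B := [set r | index_in (i1 + 1)
      (i1 + 2 * k + 2 * l + 2) r])).
      by rewrite card_index_in; lia.
    by move=> s; rewrite !inE Ap.
  - rewrite (eq_card (B := [set r | index_in (i1 + 2 * k + 2)
      (i1 + 2 * k + 2 * l + 2 * m + 3) r])).
      by rewrite card_index_in; lia.
    by move=> s; rewrite !inE Aq.
  - rewrite (eq_card (B := [set r | index_in (i1 + 2 * k + 2)
      (i1 + 2 * k + 2 * l + 2) r])).
      by rewrite card_index_in; lia.
    by move=> s; rewrite !inE Ap Aq /index_in; lia.
split=> [Ai Aj | Aj Ai].
  have [ci cj cij] := cards _ _ Ai Aj.
  have even_i : ~~ odd #|row_support A i| by rewrite ci odd_double.
  have even_j : ~~ odd #|row_support A j| by rewrite cj odd_double.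
  (* As a_jj = 0, j avoids the interval S_j, which begins at i1 + 2k + 2 and ends beyond S_i; hence
     j lies in S_i exactly when it lies in the shorter interval. *)
  have -> : index_in (i1 + 1) (i1 + 2 * k + 2) j = A i j.
    have := strictly_upper_geF A_upper (leqnn j); rewrite Ai Aj /index_in; lia.
  have signE := spin_sign_odd R (A i j) even_i even_j.
  rewrite cij cj doubleK in signE.
  split=> [|[odd_lm Aij]].
    move=> /(spin_structure_sign A_upper lt_ij even_i even_j)/signE.
    by case: (A i j); lia.
  apply: (bott_spin_structure A_upper lt_ij even_i even_j A_rows' Aij).
  have /signE : odd l.*2.+1 = A i j && odd (l + m + 1) by rewrite Aij; lia.
  by rewrite Aij.
have [cj ci cij] := cards _ _ Aj Ai; rewrite setIC in cij.
have even_i : ~~ odd #|row_support A i| by rewrite ci odd_double.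
have even_j : ~~ odd #|row_support A j| by rewrite cj odd_double.
(* The first element of S_j has 0-based index i1, so j < i1, to the left of S_i as well. *)
have Aij : A i j = false.
  have lt_i1n : (i1 < n)%N by lia.
  have : (j < Ordinal lt_i1n)%N by apply: A_upper; rewrite Aj /index_in /=; lia.
  by rewrite Ai /index_in /=; lia.
move=> /(spin_structure_sign A_upper lt_ij even_i even_j).
by move=> /(spin_sign_odd R _ even_i even_j); rewrite cij Aij /= odd_double.
Qed.
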